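(* Let $k$ be a field of characteristic zero and let $G$ be a group. (a) The group $\mathrm{Int}_k(G)/\mathrm{Inn}(G)$ acts freely on $\mathrm{H}^2_\ell(G)$. Two elements of $\mathrm{H}^2_\ell(G)$ belong to the same orbit under this action if and only if they can be represented by gauge equivalent invariant twists. (b) Gauge equivalence and equivalence modulo $\mathrm{Im}(\delta^1)$ define the same relation on invariant twists if and only if $\mathrm{Int}_k(G)/\mathrm{Inn}(G)=1$. (c) The group $\mathrm{H}^2_\ell(G)$ has a subgroup isomorphic to $\mathrm{Int}_k(G)/\mathrm{Inn}(G)$.
   Context: $k[G]$ is the group algebra with coproduct $\Delta(g)=g\otimes g$ for $g\in G$. A twist on $k[G]$ is an invertible element $F\in k[G]\otimes k[G]$ with $(F\otimes 1)(\Delta\otimes\mathrm{id})(F)=(1\otimes F)(\mathrm{id}\otimes\Delta)(F)$. It is invariant if $\Delta(a)F=F\Delta(a)$ for all $a\in k[G]$. Invariant twists form a group $Z^2$ under multiplication. The group $k[G]^\times$ acts on the set of all twists by $a\cdot F=(a\otimes a)F\Delta(a^{-1})$, and twists in the same orbit are called gauge equivalent. For $a$ in the group $A^1$ of invertible central elements of $k[G]$ put $\delta^1(a)=(a\otimes a)\Delta(a^{-1})$; $\delta^1$ is a homomorphism onto a central subgroup $\mathrm{Im}(\delta^1)$ of $Z^2$, and $\mathrm{H}^2_\ell(G)=Z^2/\mathrm{Im}(\delta^1)$. Let $N_k(G)$ be the normalizer of $G$ in $k[G]^\times$. $\mathrm{Int}_k(G)$ is the group of automorphisms of $G$ of the form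 $g\mapsto aga^{-1}$ with $a\in N_k(G)$; it contains the group $\mathrm{Inn}(G)$ of inner automorphisms, and $N_k(G)/(A^1 G)\cong\mathrm{Int}_k(G)/\mathrm{Inn}(G)$ via $a\mapsto(g\mapsto aga^{-1})$. The action in (a) is the one for which the class of $a\in N_k(G)$ sends the class of an invariant twist $F$ to the class of $a\cdot F$. *)

(* Defs.v *)
(* Subgroups, automorphism groups and quotients of arbitrary groups are cut out
   by Prop-valued conditions, made boolean with boolp's asbool. *)
From HB Require Import structures.
From mathcomp Require Import all_boot all_order all_algebra.
From mathcomp Require Import generic_quotient.
From mathcomp Require Import finmap boolp.
From mathcomp Require Import monalg.

Set Implicit Arguments.
Unset Strict Implicit.
Unset Printing Implicit Defensive.

Import GRing.Theory.
Local Open Scope quotient_scope.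
Local Open Scope ring_scope.

(* The carrier {malg k[G]} (finitely supported functions G -> k) is taken from
   monalg, but not its ring structure: monomType excludes nontrivial groups. *)
Definition galg (k : fieldType) (G : groupType) : Type := {malg k[G]}.

HB.instance Definition _ (k : fieldType) (G : groupType) :=
  GRing.Lmodule.copy (galg k G) {malg k[G]}.

(* The basis element of k[G] attached to g; locked for the sake of
   unification, as are lext and tens below. *)
HB.lock Definition gb (k : fieldType) (G : groupType) (g : G) : galg k G :=
  << g >>.
Arguments gb {k G} g.

Lemma gb_unlock (k : fieldType) (G : groupType) (g : G) :
  gb g = << g >> :> {malg k[G]}.
Proof. by rewrite unlock. Qed.

HB.lock Definition lext (k : fieldType) (G : groupType) (V : lmodType k)
    (f : G -> V) (a : galg k G) : V :=
  \sum_(g <- msupp a) a@_g *: f g.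
Arguments lext {k G V} f a.

Lemma lext_unlock (k : fieldType) (G : groupType) (V : lmodType k)
    (f : G -> V) (a : galg k G) :
  lext f a = \sum_(g <- msupp a) a@_g *: f g.
Proof. by rewrite unlock. Qed.

Section LinearExtension.
Context {k : fieldType} {G : groupType}.

Lemma galgE (a : galg k G) : a = lext gb a.
Proof.
rewrite lext_unlock {1}[a]monalgE; apply: eq_bigr => g _; apply/malgP => h.
by rewrite gb_unlock mcoeffZ !mcoeffU; case: eqP => _; rewrite ?mulr1 ?mulr0.
Qed.

Lemma lextw (V : lmodType k) (f : G -> V) (a : galg k G) (d : {fset G}) :
  (msupp a `<=` d)%fset -> lext f a = \sum_(g <- d) a@_g *: f g.
Proof.
move=> le; rewrite lext_unlock; apply: big_fset_incl => // g _ /mcoeff_outdom ->.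
by rewrite scale0r.
Qed.

Fact lext_is_linear (V : lmodType k) (f : G -> V) : linear (lext f).
Proof.
move=> c a b; pose d := (msupp (c *: a + b) `|` (msupp a `|` msupp b))%fset.
rewrite !(@lextw _ f _ d); last first.
- by rewrite /d; apply/fsubsetP => x; rewrite !inE => ->.
- by rewrite /d; apply/fsubsetP => x; rewrite !inE => ->; rewrite !orbT.
- by rewrite /d; apply/fsubsetP => x; rewrite !inE => ->; rewrite !orbT.
rewrite scaler_sumr -big_split /=; apply: eq_bigr => g _.
by rewrite mcoeffD mcoeffZ scalerDl scalerA.
Qed.

HB.instance Definition _ (V : lmodType k) (f : G -> V) :=
  GRing.isLinear.Build k (galg k G) V *:%R (lext f) (lext_is_linear f).

Lemma lextD (V : lmodType k) (f : G -> V) : {morph lext f : a b / a + b}.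
Proof. exact: linearD. Qed.

Lemma lextZ (V : lmodType k) (f : G -> V) c a :
  lext f (c *: a) = c *: lext f a.
Proof. exact: linearZ. Qed.

Lemma lext0 (V : lmodType k) (f : G -> V) : lext f 0 = 0.
Proof. exact: linear0. Qed.

Lemma lext_gb (V : lmodType k) (f : G -> V) g : lext f (gb g) = f g.
Proof.
by rewrite gb_unlock (lextw _ msuppU_le) big_seq_fset1 mcoeffUU scale1r.
Qed.

Lemma galg_ind (P : galg k G -> Prop) :
  P 0 -> (forall a b, P a -> P b -> P (a + b)) ->
  (forall c a, P a -> P (c *: a)) -> (forall g, P (gb g)) -> forall a, P a.
Proof.
move=> P0 PD PZ Pg a; rewrite [a]galgE lext_unlock.
by elim/big_rec: _ => // g x _ Px; apply: PD => //; apply: PZ.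
Qed.

Lemma lin_galgP (V : lmodType k) (f f' : {linear galg k G -> V}) :
  (forall g, f (gb g) = f' (gb g)) -> f =1 f'.
Proof.
move=> ff'; elim/galg_ind => [|a b IHa IHb|c a IHa|//].
- by rewrite !linear0.
- by rewrite !linearD IHa IHb.
- by rewrite !linearZ IHa.
Qed.

Lemma lext_eq (V : lmodType k) (f f' : G -> V) : f =1 f' -> lext f =1 lext f'.
Proof. by move=> ff' a; rewrite !lext_unlock; apply: eq_bigr => g _; rewrite ff'. Qed.

Lemma lextDf (V : lmodType k) (f f' : G -> V) a :
  lext (fun g => f g + f' g) a = lext f a + lext f' a.
Proof.
by rewrite !lext_unlock -big_split; apply: eq_bigr => g _; rewrite scalerDr.
Qed.

Lemma lextZf (V : lmodType k) c (f : G -> V) a :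
  lext (fun g => c *: f g) a = c *: lext f a.
Proof.
rewrite !lext_unlock scaler_sumr; apply: eq_bigr => g _.
by rewrite !scalerA mulrC.
Qed.

Lemma gb_inj : injective (gb : G -> galg k G).
Proof.
move=> g h /(congr1 (mcoeff h)); rewrite !gb_unlock !mcoeffU eqxx.
by case: eqP => // _ /eqP; rewrite eq_sym oner_eq0.
Qed.

End LinearExtension.
Arguments galg_ind [k G].

Section GroupAlgebra.
Context {k : fieldType} {G : groupType}.
Implicit Types (a b c : galg k G).

Definition galg_one : galg k G := gb 1%g.

Definition galg_mul a b : galg k G :=
  lext (fun x => lext (fun y => gb (x * y)%g) b) a.

Let mulDl : left_distributive galg_mul +%R.
Proof. by move=> a b c; rewrite /galg_mul linearD. Qed.

Let mulDr : right_distributive galg_mul +%R.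
Proof.
move=> a b c; rewrite /galg_mul -lextDf.
by apply: lext_eq => x; rewrite linearD.
Qed.

Let mulZl x a b : galg_mul (x *: a) b = x *: galg_mul a b.
Proof. by rewrite /galg_mul linearZ. Qed.

Let mulZr x a b : galg_mul a (x *: b) = x *: galg_mul a b.
Proof.
by rewrite /galg_mul -lextZf; apply: lext_eq => y; rewrite linearZ.
Qed.

Let mul0l a : galg_mul 0 a = 0.
Proof. by rewrite /galg_mul linear0. Qed.

Let gmul0r a : galg_mul a 0 = 0.
Proof. by have := mulZr 0 a 0; rewrite !scale0r. Qed.

Let mulgb x y : galg_mul (gb x) (gb y) = gb (x * y)%g.
Proof. by rewrite /galg_mul !lext_gb. Qed.

Let mulA : associative galg_mul.
Proof.
move=> a b c; elim/galg_ind: a => [|a a' IH IH'|x a IH|x].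
- by rewrite !mul0l.
- by rewrite !mulDl IH IH'.
- by rewrite !mulZl IH.
elim/galg_ind: b => [|b b' IH IH'|y b IH|y].
- by rewrite !(gmul0r, mul0l).
- by rewrite !(mulDl, mulDr) IH IH'.
- by rewrite !(mulZl, mulZr) IH.
elim/galg_ind: c => [|c c' IH IH'|z c IH|z].
- by rewrite !gmul0r.
- by rewrite !mulDr IH IH'.
- by rewrite !mulZr IH.
by rewrite !mulgb mulgA.
Qed.

Let mul1l : left_id galg_one galg_mul.
Proof.
by move=> a; rewrite /galg_mul lext_gb [RHS]galgE; apply: lext_eq => y; rewrite mul1g.
Qed.

Let gmul1r : right_id galg_one galg_mul.
Proof.
move=> a; rewrite /galg_mul [RHS]galgE; apply: lext_eq => x.
by rewrite lext_gb mulg1.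
Qed.

Let one_neq0 : galg_one != 0.
Proof.
apply/eqP => /(congr1 (mcoeff 1%g)); rewrite /galg_one gb_unlock mcoeffUU mcoeff0.
by apply/eqP; rewrite oner_eq0.
Qed.

HB.instance Definition _ := GRing.Zmodule_isNzRing.Build (galg k G)
  mulA mul1l gmul1r mulDl mulDr one_neq0.

Let scaleAl (x : k) (a b : galg k G) : x *: (a * b) = (x *: a) * b.
Proof. exact/esym/mulZl. Qed.

Let scaleAr (x : k) (a b : galg k G) : x *: (a * b) = a * (x *: b).
Proof. exact/esym/mulZr. Qed.

HB.instance Definition _ :=
  GRing.Lmodule_isLalgebra.Build k (galg k G) scaleAl.
HB.instance Definition _ :=
  GRing.Lalgebra_isAlgebra.Build k (galg k G) scaleAr.

Lemma gbM x y : gb (x * y)%g = gb x * gb y :> galg k G.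
Proof. exact/esym/mulgb. Qed.

Lemma gb1 : gb 1%g = 1 :> galg k G.
Proof. by []. Qed.

Lemma lextM (A : algType k) (f : G -> A) :
  {morph f : x y / (x * y)%g >-> x * y} -> {morph lext f : a b / a * b}.
Proof.
move=> fM a b; elim/galg_ind: a => [|a a' IH IH'|x a IH|x].
- by rewrite mul0r linear0 mul0r.
- by rewrite mulrDl !linearD /= mulrDl IH IH'.
- by rewrite -scalerAl !linearZ /= -scalerAl IH.
elim/galg_ind: b => [|b b' IH IH'|y b IH|y].
- by rewrite mulr0 linear0 mulr0.
- by rewrite mulrDr !linearD /= mulrDr IH IH'.
- by rewrite -scalerAr !linearZ /= -scalerAr IH.
by rewrite -gbM !lext_gb fM.
Qed.

End GroupAlgebra.

(* k[G] (x) k[H] is modelled by k[G * H], with gb (g, h) in the role of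
   g (x) h; [tens_universal] is the universal property. *)
HB.lock Definition tens (k : fieldType) (G H : groupType)
    (a : galg k G) (b : galg k H) : galg k (G * H)%type :=
  lext (fun x => lext (fun y => gb (x, y)) b) a.
Arguments tens {k G H} a b.

Lemma tens_unlock (k : fieldType) (G H : groupType)
    (a : galg k G) (b : galg k H) :
  tens a b = lext (fun x => lext (fun y => gb (x, y)) b) a.
Proof. by rewrite unlock. Qed.

Section Tensor.
Context {k : fieldType}.

Section Theory.
Context {G H : groupType}.
Implicit Types (a : galg k G) (b : galg k H).

Lemma tens_gb (x : G) (y : H) : tens (gb x) (gb y) = gb (x, y) :> galg k (G * H)%type.
Proof. by rewrite !tens_unlock !lext_gb. Qed.

Lemma tensDl a a' b : tens (a + a') b = tens a b + tens a' b.
Proof. by rewrite !tens_unlock linearD. Qed.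

Lemma tensDr a b b' : tens a (b + b') = tens a b + tens a b'.
Proof. by rewrite !tens_unlock -lextDf; apply: lext_eq => x; rewrite linearD. Qed.

Lemma tensZl x a b : tens (x *: a) b = x *: tens a b.
Proof. by rewrite !tens_unlock linearZ. Qed.

Lemma tensZr x a b : tens a (x *: b) = x *: tens a b.
Proof. by rewrite !tens_unlock -lextZf; apply: lext_eq => y; rewrite linearZ. Qed.

Lemma tens0l b : tens (0 : galg k G) b = 0.
Proof. by have := tensZl 0 0 b; rewrite !scale0r. Qed.

Lemma tens0r a : tens a (0 : galg k H) = 0.
Proof. by have := tensZr 0 a 0; rewrite !scale0r. Qed.

Lemma tens_ind (P : galg k (G * H)%type -> Prop) :
  P 0 -> (forall u v, P u -> P v -> P (u + v)) ->
  (forall c u, P u -> P (c *: u)) -> (forall a b, P (tens a b)) ->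
  forall u, P u.
Proof.
move=> P0 PD PZ Pt; apply: galg_ind => // -[x y].
by rewrite -tens_gb.
Qed.

Lemma tens_universal (V : lmodType k) (f : galg k G -> galg k H -> V) :
  (forall a, linear (f a)) -> (forall b, linear (f^~ b)) ->
  exists2 L : {linear galg k (G * H)%type -> V},
    forall a b, L (tens a b) = f a b &
    forall L' : {linear galg k (G * H)%type -> V},
      (forall a b, L' (tens a b) = f a b) -> L' =1 L.
Proof.
move=> fr fl.
exists (lext (fun p : G * H => f (gb p.1) (gb p.2)) : {linear _ -> _}).
move=> a b.
  have f0l b' : f 0 b' = 0.
    by have := fl b' 1 0 0; rewrite !scale1r addr0 => /eqP;
       rewrite -subr_eq0 opprD addNKr oppr_eq0 => /eqP.
  have f0r a' : f a' 0 = 0.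
    by have := fr a' 1 0 0; rewrite !scale1r addr0 => /eqP;
       rewrite -subr_eq0 opprD addNKr oppr_eq0 => /eqP.
  elim/galg_ind: a => [|a a' IH IH'|x a IH|x].
  - by rewrite tens0l linear0 f0l.
  - by have := fl b 1 a a'; rewrite !scale1r tensDl linearD /= IH IH'.
  - by have := fl b x a 0; rewrite !addr0 tensZl linearZ /= f0l addr0 IH.
  elim/galg_ind: b => [|b b' IH IH'|y b IH|y].
  - by rewrite tens0r linear0 f0r.
  - by have := fr (gb x) 1 b b'; rewrite !scale1r tensDr linearD /= IH IH'.
  - by have := fr (gb x) y b 0; rewrite !addr0 tensZr linearZ /= f0r addr0 IH.
  by rewrite tens_gb /= lext_gb.
move=> L LE; apply: lin_galgP => -[x y] /=.
by rewrite -tens_gb LE tens_gb lext_gb.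
Qed.

Lemma tens11 : tens (1 : galg k G) (1 : galg k H) = 1.
Proof. by rewrite -!gb1 tens_gb. Qed.

Lemma tensM a a' b b' : tens (a * a') (b * b') = tens a b * tens a' b'.
Proof.
elim/galg_ind: a => [|a c IH IH'|x a IH|x].
- by rewrite mul0r !tens0l mul0r.
- by rewrite (mulrDl a c a') !tensDl (mulrDl (tens a b) (tens c b)) IH IH'.
- by rewrite -scalerAl !tensZl -scalerAl IH.
elim/galg_ind: a' => [|a c IH IH'|x' a IH|x'].
- by rewrite mulr0 !tens0l mulr0.
- by rewrite (mulrDr (gb x) a c) !tensDl (mulrDr _ (tens a b')) IH IH'.
- by rewrite -scalerAr !tensZl -scalerAr IH.
elim/galg_ind: b => [|a c IH IH'|y a IH|y].
- by rewrite mul0r !tens0r mul0r.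
- by rewrite (mulrDl a c b') !tensDr (mulrDl (tens _ a)) IH IH'.
- by rewrite -scalerAl !tensZr -scalerAl IH.
elim/galg_ind: b' => [|a c IH IH'|y' a IH|y'].
- by rewrite mulr0 !tens0r mulr0.
- by rewrite (mulrDr (gb y) a c) !tensDr (mulrDr _ (tens _ a)) IH IH'.
- by rewrite -scalerAr !tensZr -scalerAr IH.
by rewrite -!gbM !tens_gb -gbM.
Qed.

End Theory.

Definition tmap (G G' H H' : groupType)
    (phi : {linear galg k G -> galg k G'})
    (psi : {linear galg k H -> galg k H'}) :
    galg k (G * H)%type -> galg k (G' * H')%type :=
  lext (fun p => tens (phi (gb p.1)) (psi (gb p.2))).

Lemma tmap_tens (G G' H H' : groupType)
    (phi : {linear galg k G -> galg k G'})
    (psi : {linear galg k H -> galg k H'}) a b :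
  tmap phi psi (tens a b) = tens (phi a) (psi b).
Proof.
rewrite /tmap; elim/galg_ind: a => [|a a' IH IH'|x a IH|x].
- by rewrite tens0l lext0 linear0 tens0l.
- by rewrite tensDl lextD (linearD phi) tensDl IH IH'.
- by rewrite tensZl lextZ (linearZZ phi) tensZl IH.
elim/galg_ind: b => [|b b' IH IH'|y b IH|y].
- by rewrite tens0r lext0 linear0 tens0r.
- by rewrite tensDr lextD (linearD psi) tensDr IH IH'.
- by rewrite tensZr lextZ (linearZZ psi) tensZr IH.
by rewrite tens_gb /= lext_gb.
Qed.

Lemma tmapM (G G' H H' : groupType)
    (phi : {linear galg k G -> galg k G'})
    (psi : {linear galg k H -> galg k H'}) :
  {morph phi : a b / a * b} -> {morph psi : a b / a * b} ->
  {morph tmap phi psi : a b / a * b}.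
Proof.
move=> phiM psiM; apply: lextM => -[x y] [x' y'] /=.
by rewrite !gbM phiM psiM tensM.
Qed.

(* The canonical identification U (x) (V (x) W) = (U (x) V) (x) W. *)
Definition tassoc (G H K : groupType) :
    galg k (G * (H * K))%type -> galg k (G * H * K)%type :=
  lext (fun p => gb (p.1, p.2.1, p.2.2)).

Lemma tassoc_tens (G H K : groupType)
    (a : galg k G) (b : galg k H) (c : galg k K) :
  tassoc (tens a (tens b c)) = tens (tens a b) c.
Proof.
rewrite /tassoc; elim/galg_ind: a => [|a a' IH IH'|x a IH|x].
- by rewrite !tens0l lext0.
- by rewrite !tensDl lextD IH IH'.
- by rewrite !tensZl lextZ IH.
elim/galg_ind: b => [|b b' IH IH'|y b IH|y].
- by rewrite !(tens0l, tens0r) lext0.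
- by rewrite (tensDl b b' c) (tensDr (gb x) (tens b c)) (tensDr (gb x) b b') lextD
    IH IH' (tensDl (tens (gb x) b)).
- by rewrite (tensZl y b) (tensZr y (gb x) b) (tensZr y (gb x)) lextZ IH
    (tensZl y (tens _ _)).
elim/galg_ind: c => [|c c' IH IH'|z c IH|z].
- by rewrite !tens0r lext0.
- by rewrite !tensDr lextD IH IH'.
- by rewrite !tensZr lextZ IH.
by rewrite !tens_gb lext_gb.
Qed.

Lemma tassocM (G H K : groupType) : {morph @tassoc G H K : a b / a * b}.
Proof. by apply: lextM => x y; rewrite -gbM. Qed.

End Tensor.

Section Units.
Variable R : nzRingType.

(* A unit is stored together with its inverse. *)
Record runit := RUnit {
  runit_pair : R * R;
  _ : (runit_pair.1 * runit_pair.2 == 1) && (runit_pair.2 * runit_pair.1 == 1)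
}.

HB.instance Definition _ := [isSub for runit_pair].
HB.instance Definition _ := [Choice of runit by <:].

Definition uval (u : runit) : R := (runit_pair u).1.
Definition uinv (u : runit) : R := (runit_pair u).2.

Lemma uvalK u : uval u * uinv u = 1.
Proof. by have /andP[/eqP] := valP u. Qed.

Lemma uinvK u : uinv u * uval u = 1.
Proof. by have /andP[_ /eqP] := valP u. Qed.

Lemma uval_inj : injective uval.
Proof.
move=> u v uv; apply: val_inj; rewrite /= [LHS]surjective_pairing.
rewrite [RHS]surjective_pairing -/(uval u) -/(uval v) -/(uinv u) -/(uinv v) uv.
congr pair.
by rewrite -[uinv u]mulr1 -(uvalK v) -uv mulrA uinvK mul1r.
Qed.

Fact runit_subproof (x y : R) (xy : x * y = 1) (yx : y * x = 1) :
  (((x, y).1 * (x, y).2 == 1) && ((x, y).2 * (x, y).1 == 1)).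
Proof. by rewrite /= xy yx eqxx. Qed.

Definition mk_runit x y xy yx : runit := RUnit (@runit_subproof x y xy yx).

Definition runit_one : runit := mk_runit (mulr1 1) (mulr1 1).

Fact runit_mul1 u v : (uval u * uval v) * (uinv v * uinv u) = 1.
Proof. by rewrite mulrA -(mulrA (uval u)) uvalK mulr1 uvalK. Qed.

Fact runit_mul2 u v : (uinv v * uinv u) * (uval u * uval v) = 1.
Proof. by rewrite mulrA -(mulrA (uinv v)) uinvK mulr1 uinvK. Qed.

Definition runit_mul u v : runit :=
  mk_runit (runit_mul1 u v) (runit_mul2 u v).

Definition runit_inv u : runit := mk_runit (uinvK u) (uvalK u).

Let mulA : associative runit_mul.
Proof. by move=> u v w; apply: uval_inj; rewrite /uval /= mulrA. Qed.
Let mul1u : left_id runit_one runit_mul.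
Proof. by move=> u; apply: uval_inj; rewrite /uval /= mul1r. Qed.
Let mulu1 : right_id runit_one runit_mul.
Proof. by move=> u; apply: uval_inj; rewrite /uval /= mulr1. Qed.
Let mulVu : left_inverse runit_one runit_inv runit_mul.
Proof. by move=> u; apply: uval_inj; rewrite /uval /=; apply: uinvK. Qed.
Let muluV : right_inverse runit_one runit_inv runit_mul.
Proof. by move=> u; apply: uval_inj; rewrite /uval /=; apply: uvalK. Qed.

HB.instance Definition _ := isGroup.Build runit mulA mul1u mulu1 mulVu muluV.

Lemma uvalM u v : uval (u * v)%g = uval u * uval v. Proof. by []. Qed.
Lemma uval1 : uval 1%g = 1. Proof. by []. Qed.
Lemma uvalV u : uval u^-1%g = uinv u. Proof. by []. Qed.
Lemma uvalVK u : uval u * uval u^-1%g = 1. Proof. exact: uvalK. Qed.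
Lemma uvalKV u : uval u^-1%g * uval u = 1. Proof. exact: uinvK. Qed.

End Units.

Section Quotient.
Context {T : groupType}.

Record normsubg := NormSubg {
  normsubg_pred :> {pred T};
  normsubg_closed : group_closed normsubg_pred;
  normsubg_norm : forall x y, x \in normsubg_pred -> (x ^ y)%g \in normsubg_pred
}.

Variable S : normsubg.

Definition coset_rel : rel T := fun x y => (x^-1 * y)%g \in S.

Let S1 : 1%g \in S. Proof. by case: (normsubg_closed S). Qed.
Let SV x : x \in S -> (x^-1)%g \in S.
Proof. exact: group_closedV (normsubg_closed S) x. Qed.
Let SM x y : x \in S -> y \in S -> (x * y)%g \in S.
Proof. exact: group_closedM (normsubg_closed S) x y. Qed.

Fact coset_rel_refl : reflexive coset_rel.
Proof. by move=> x; rewrite /coset_rel mulVg. Qed.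

Fact coset_rel_sym : symmetric coset_rel.
Proof.
by move=> x y; apply/idP/idP => /SV; rewrite /coset_rel invgM invgK.
Qed.

Fact coset_rel_trans : transitive coset_rel.
Proof. by move=> y x z xy yz; have := SM xy yz; rewrite mulgA mulgK. Qed.

Canonical coset_equiv :=
  EquivRel coset_rel coset_rel_refl coset_rel_sym coset_rel_trans.

Definition quotg : Type := {eq_quot coset_equiv}.
HB.instance Definition _ := Choice.on quotg.
HB.instance Definition _ := EqQuotient.on quotg.

Definition qclass (x : T) : quotg := \pi_quotg x.

Lemma qclass_eqP x y : qclass x = qclass y <-> (x^-1 * y)%g \in S.
Proof. by split=> [/eqP|]; rewrite /qclass ?eqmodE // => ?; apply/eqP; rewrite eqmodE. Qed.

Definition quotg_mul (x y : quotg) : quotg := qclass (repr x * repr y)%g.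
Definition quotg_inv (x : quotg) : quotg := qclass (repr x)^-1%g.

Lemma qclassK x : qclass (repr x) = x. Proof. exact: reprK. Qed.

Let repr_qclass x : exists2 s, s \in S & repr (qclass x) = (x * s)%g.
Proof.
exists (x^-1 * repr (qclass x))%g; last by rewrite mulVKg.
by apply/qclass_eqP; rewrite qclassK.
Qed.

Let qmulE x y : quotg_mul (qclass x) (qclass y) = qclass (x * y)%g.
Proof.
rewrite /quotg_mul; have [s Ss ->] := repr_qclass x.
have [t St ->] := repr_qclass y; apply/esym/qclass_eqP.
have -> : ((x * y)^-1 * (x * s * (y * t)) = s ^ y * t)%g.
  by rewrite invgM conjgE !mulgA mulgVK.
by apply: SM => //; apply: normsubg_norm.
Qed.

Let qinvE x : quotg_inv (qclass x) = qclass x^-1%g.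
Proof.
rewrite /quotg_inv; have [s Ss ->] := repr_qclass x.
apply/esym/qclass_eqP; rewrite invgK invgM mulgA.
have -> : (x * s^-1 * x^-1 = (s^-1) ^ x^-1)%g by rewrite conjgE invgK mulgA.
by apply: normsubg_norm; apply: SV.
Qed.

Let qA : associative quotg_mul.
Proof.
by move=> x y z; rewrite -(qclassK x) -(qclassK y) -(qclassK z) !qmulE mulgA.
Qed.
Let q1l : left_id (qclass 1%g) quotg_mul.
Proof. by move=> x; rewrite -(qclassK x) qmulE mul1g. Qed.
Let q1r : right_id (qclass 1%g) quotg_mul.
Proof. by move=> x; rewrite -(qclassK x) qmulE mulg1. Qed.
Let qVl : left_inverse (qclass 1%g) quotg_inv quotg_mul.
Proof. by move=> x; rewrite -(qclassK x) qinvE qmulE mulVg. Qed.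
Let qVr : right_inverse (qclass 1%g) quotg_inv quotg_mul.
Proof. by move=> x; rewrite -(qclassK x) qinvE qmulE mulgV. Qed.

HB.instance Definition _ := isGroup.Build quotg qA q1l q1r qVl qVr.

Lemma qclassM x y : qclass (x * y)%g = (qclass x * qclass y)%g.
Proof. exact/esym/qmulE. Qed.

Lemma qclass1 : qclass 1%g = 1%g. Proof. by []. Qed.

End Quotient.
Arguments normsubg : clear implicits.

Section GroupActions.
Variables (T : groupType) (X : Type) (act : T -> X -> X).

Definition is_gaction :=
  (forall x, act 1%g x = x) /\
  (forall s t x, act (s * t)%g x = act s (act t x)).

Definition free_gaction := forall s x, act s x = x -> s = 1%g.

Definition same_orbit (x y : X) := exists s, act s x = y.

End GroupActions.

Section Automorphisms.
Variable G : groupType.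

Definition is_gaut : pred (G -> G) :=
  fun f => `[< {morph f : x y / (x * y)%g} /\ bijective f >].

Record gaut := GAut { gaut_fun :> G -> G; gautP : is_gaut gaut_fun }.

HB.instance Definition _ := [isSub for gaut_fun].
HB.instance Definition _ := [Choice of gaut by <:].

Lemma gautM (f : gaut) : {morph f : x y / (x * y)%g}.
Proof. by have /asboolP[] := gautP f. Qed.

Lemma gaut_bij (f : gaut) : bijective f.
Proof. by have /asboolP[] := gautP f. Qed.

Lemma gaut_eq (f f' : gaut) : f =1 f' -> f = f'.
Proof. by move=> ff'; apply: val_inj; apply: funext. Qed.

Fact gaut_one_subproof : is_gaut (@id G).
Proof. by apply/asboolP; split=> //; exists id. Qed.

Definition gaut_one := GAut gaut_one_subproof.

Fact gaut_mul_subproof (f f' : gaut) : is_gaut (f \o f').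
Proof.
apply/asboolP; split=> [x y|]; first by rewrite /= !gautM.
exact: bij_comp (gaut_bij f) (gaut_bij f').
Qed.

Definition gaut_mul f f' := GAut (gaut_mul_subproof f f').

Fact gaut_inv_ex (f : gaut) : exists g : gaut, cancel g f /\ cancel f g.
Proof.
have [g fg gf] := gaut_bij f.
suff gP : is_gaut g by exists (GAut gP).
apply/asboolP; split; last by exists f.
by move=> x y; apply: (can_inj fg); rewrite gautM !gf.
Qed.

Definition gaut_inv (f : gaut) : gaut := projT1 (cid (gaut_inv_ex f)).

Let invP f : cancel (gaut_inv f) f /\ cancel f (gaut_inv f).
Proof. by rewrite /gaut_inv; case: cid. Qed.

Let mulA : associative gaut_mul.
Proof. by move=> f g h; apply: gaut_eq. Qed.
Let mul1 : left_id gaut_one gaut_mul.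
Proof. by move=> f; apply: gaut_eq. Qed.
Let mulr1 : right_id gaut_one gaut_mul.
Proof. by move=> f; apply: gaut_eq. Qed.
Let mulV : left_inverse gaut_one gaut_inv gaut_mul.
Proof. by move=> f; apply: gaut_eq => x /=; rewrite (invP f).2. Qed.
Let mulrV : right_inverse gaut_one gaut_inv gaut_mul.
Proof. by move=> f; apply: gaut_eq => x /=; rewrite (invP f).1. Qed.

HB.instance Definition _ := isGroup.Build gaut mulA mul1 mulr1 mulV mulrV.

Lemma gaut1E x : (1%g : gaut) x = x. Proof. by []. Qed.
Lemma gautME (f f' : gaut) x : (f * f')%g x = f (f' x). Proof. by []. Qed.
Lemma gautK (f : gaut) : cancel f (f^-1)%g. Proof. exact: (invP f).2. Qed.
Lemma gautKV (f : gaut) : cancel (f^-1)%g f. Proof. exact: (invP f).1. Qed.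

Lemma gaut_1 (f : gaut) : f 1%g = 1%g.
Proof. by apply: (mulgI (f 1%g)); rewrite -gautM !mulg1. Qed.
Lemma gautV (f : gaut) : {morph f : x / (x^-1)%g}.
Proof. by move=> x; apply/esym/mulg1_eq; rewrite -gautM mulgV gaut_1. Qed.

End Automorphisms.

Section UnitMaps.

Definition umap (R S : nzRingType) (f : R -> S) (f1 : f 1 = 1)
    (fM : {morph f : x y / x * y}) (u : runit R) : runit S :=
  mk_runit (etrans (esym (fM (uval u) (uinv u)))
             (etrans (congr1 f (uvalK u)) f1))
           (etrans (esym (fM (uinv u) (uval u)))
             (etrans (congr1 f (uinvK u)) f1)).

Lemma uval_umap (R S : nzRingType) (f : R -> S) f1 fM (u : runit R) :
  uval (@umap R S f f1 fM u) = f (uval u).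
Proof. by []. Qed.

Lemma umapM (R S : nzRingType) (f : R -> S) f1 fM :
  {morph @umap R S f f1 fM : u v / (u * v)%g}.
Proof. by move=> u v; apply: uval_inj; rewrite !(uval_umap, uvalM) fM. Qed.

Lemma umap1 (R S : nzRingType) (f : R -> S) f1 fM :
  @umap R S f f1 fM 1%g = 1%g.
Proof. by apply: uval_inj; rewrite uval_umap !uval1. Qed.

Lemma umapV (R S : nzRingType) (f : R -> S) f1 fM :
  {morph @umap R S f f1 fM : u / (u^-1)%g}.
Proof.
by move=> u; apply/esym/mulg1_eq; rewrite -umapM mulgV umap1.
Qed.

Section GroupAlgebraUnits.
Context {k : fieldType}.

Fact gbV1 (G : groupType) (g : G) : gb g * gb g^-1%g = 1 :> galg k G.
Proof. by rewrite -gbM mulgV. Qed.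
Fact gbV2 (G : groupType) (g : G) : gb g^-1%g * gb g = 1 :> galg k G.
Proof. by rewrite -gbM mulVg. Qed.

(* The elements of G seen in k[G]^x. *)
Definition ugb (G : groupType) (g : G) : runit (galg k G) :=
  mk_runit (gbV1 g) (gbV2 g).

Fact tensV1 (G H : groupType) (a : runit (galg k G)) (b : runit (galg k H)) :
  tens (uval a) (uval b) * tens (uinv a) (uinv b) = 1.
Proof. by rewrite -tensM !uvalK tens11. Qed.
Fact tensV2 (G H : groupType) (a : runit (galg k G)) (b : runit (galg k H)) :
  tens (uinv a) (uinv b) * tens (uval a) (uval b) = 1.
Proof. by rewrite -tensM !uinvK tens11. Qed.

Definition utens (G H : groupType)
    (a : runit (galg k G)) (b : runit (galg k H)) :
    runit (galg k (G * H)%type) :=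
  mk_runit (tensV1 a b) (tensV2 a b).

Lemma utensM (G H : groupType) (a a' : runit (galg k G))
    (b b' : runit (galg k H)) :
  utens (a * a')%g (b * b')%g = (utens a b * utens a' b')%g.
Proof. by apply: uval_inj; rewrite /uval /= tensM. Qed.

Lemma utens11 (G H : groupType) :
  utens (1%g : runit (galg k G)) (1%g : runit (galg k H)) = 1%g.
Proof. by apply: uval_inj; rewrite /uval /= tens11. Qed.

End GroupAlgebraUnits.
End UnitMaps.

Section Twists.
Context {k : fieldType} {G : groupType}.
Implicit Types (a b : runit (galg k G)) (F : runit (galg k (G * G)%type)).

Definition delta : galg k G -> galg k (G * G)%type :=
  lext (fun g => tens (gb g) (gb g)).

HB.instance Definition _ :=
  GRing.Linear.copy delta (lext (fun g : G => tens (gb g) (gb g))).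

Lemma delta_gb g : delta (gb g) = gb (g, g).
Proof. by rewrite /delta lext_gb tens_gb. Qed.

Lemma delta1 : delta 1 = 1.
Proof. by rewrite -!gb1 delta_gb. Qed.

Lemma deltaM : {morph delta : x y / x * y}.
Proof. by apply: lextM => x y; rewrite !gbM tensM. Qed.

Definition udelta : runit (galg k G) -> runit (galg k (G * G)%type) :=
  umap delta1 deltaM.

(* (F (x) 1) (Delta (x) id)(F) = (1 (x) F) (id (x) Delta)(F), where the right
   side is computed in k[G] (x) (k[G] (x) k[G]) and then reassociated. *)
Definition is_twist (F : galg k (G * G)%type) : Prop :=
  tens F (1 : galg k G) * tmap delta idfun F
  = tassoc (tens (1 : galg k G) F * tmap idfun delta F).

Definition is_invariant (F : galg k (G * G)%type) : Prop :=
  forall a : galg k G, delta a * F = F * delta a.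

Definition invtwist_pred : pred (runit (galg k (G * G)%type)) :=
  fun F => `[< is_twist (uval F) /\ is_invariant (uval F) >].

(* a . F = (a (x) a) F Delta(a^-1) *)
Definition gauge a F : runit (galg k (G * G)%type) :=
  (utens a a * F * udelta a^-1)%g.

Definition gauge_equiv F F' : Prop := exists a, F' = gauge a F.

Let T1 (F : galg k (G * G)%type) := tens F (1 : galg k G).
Let D1 := tmap (delta : {linear _ -> _}) (idfun : {linear galg k G -> _}).
Let T2 (F : galg k (G * G)%type) := tassoc (tens (1 : galg k G) F).
Let D2 (F : galg k (G * G)%type) :=
  tassoc (tmap (idfun : {linear galg k G -> _}) (delta : {linear _ -> _}) F).

Let T1M : {morph T1 : x y / x * y}.
Proof. by move=> x y; rewrite /T1 -tensM mulr1. Qed.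
Let T2M : {morph T2 : x y / x * y}.
Proof. by move=> x y; rewrite /T2 -tassocM -tensM mulr1. Qed.
Let D1M : {morph D1 : x y / x * y}.
Proof. by apply: tmapM => //; apply: deltaM. Qed.
Let D2M : {morph D2 : x y / x * y}.
Proof. by move=> x y; rewrite /D2 -tassocM tmapM //; apply: deltaM. Qed.
Let tassoc1 : tassoc (1 : galg k (G * (G * G))%type) = 1.
Proof. by rewrite /tassoc -gb1 lext_gb. Qed.
Let T11 : T1 1 = 1. Proof. exact: tens11. Qed.
Let T21 : T2 1 = 1. Proof. by rewrite /T2 tens11. Qed.
Let D1t x y : D1 (tens x y) = tens (delta x) y.
Proof. exact: tmap_tens. Qed.
Let D2t x y : D2 (tens x y) = tassoc (tens x (delta y)).
Proof. by rewrite /D2 tmap_tens. Qed.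
Let D11 : D1 1 = 1. Proof. by rewrite -tens11 D1t delta1 tens11. Qed.
Let D21 : D2 1 = 1. Proof. by rewrite -tens11 D2t delta1 tens11. Qed.
Let coassoc x : D1 (delta x) = D2 (delta x).
Proof.
elim/galg_ind: x => [|x y IH IH'|c x IH|g].
- by rewrite linear0 /D2 /D1 /tmap /tassoc !lext0.
- by rewrite linearD /D2 /D1 /tmap /tassoc !lextD in IH IH' *; rewrite IH IH'.
- by rewrite linearZ /D2 /D1 /tmap /tassoc !lextZ in IH *; rewrite IH.
by rewrite delta_gb -tens_gb D1t D2t delta_gb -tens_gb tassoc_tens.
Qed.

Let t1 := umap T11 T1M.
Let t2 := umap T21 T2M.
Let d1 := umap D11 D1M.
Let d2 := umap D21 D2M.

Let twistP F : is_twist (uval F) <-> (t1 F * d1 F = t2 F * d2 F)%g.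
Proof.
rewrite /is_twist tassocM; split => [E|/(congr1 (@uval _))] //.
exact: uval_inj.
Qed.

Let t1d1C F F' : is_invariant (uval F) -> (t1 F * d1 F' = d1 F' * t1 F)%g.
Proof.
move=> inv; apply: uval_inj; rewrite !uvalM !uval_umap.
move: (uval F'); apply: tens_ind => [|u v IH IH'|c u IH|x y].
- by rewrite /D1 /tmap lext0 mulr0 mul0r.
- by rewrite /D1 /tmap lextD mulrDr mulrDl -/(tmap _ _ u) -/(tmap _ _ v) -/D1 IH IH'.
- by rewrite /D1 /tmap lextZ -scalerAr -scalerAl -/(tmap _ _ u) -/D1 IH.
by rewrite D1t /T1 -!tensM mulr1 mul1r inv.
Qed.

Let t2d2C F F' : is_invariant (uval F) -> (t2 F * d2 F' = d2 F' * t2 F)%g.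
Proof.
move=> inv; apply: uval_inj; rewrite !uvalM !uval_umap /T2 /D2 -!tassocM.
congr tassoc; move: (uval F'); apply: tens_ind => [|u v IH IH'|c u IH|x y].
- by rewrite /tmap lext0 mulr0 mul0r.
- by rewrite {1 2}/tmap lextD mulrDr mulrDl IH IH'.
- by rewrite {1 2}/tmap lextZ -scalerAr -scalerAl IH.
by rewrite tmap_tens -!tensM mulr1 mul1r inv.
Qed.

Fact invtwist_closed : group_closed invtwist_pred.
Proof.
have inv1 : is_invariant 1 by move=> x; rewrite mulr1 mul1r.
split=> [|F F' /asboolP[/twistP tF iF] /asboolP[/twistP tF' iF']].
  apply/asboolP; split=> //; apply/(twistP 1%g).
  by rewrite /t1 /t2 /d1 /d2 !umap1.
have iV : is_invariant (uval F'^-1%g).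
  move=> x; rewrite -[LHS]mul1r -(uvalKV F') -!mulrA.
  by congr (_ * _); rewrite !mulrA -iF' -mulrA uvalVK mulr1.
have tV : (t1 F'^-1 * d1 F'^-1 = t2 F'^-1 * d2 F'^-1)%g.
  rewrite t1d1C // t2d2C // !/t1 !/t2 !/d1 !/d2 !umapV -!invgM.
  by congr (_ ^-1)%g.
apply/asboolP; split; last by move=> x; rewrite uvalM mulrA iF -mulrA iV mulrA.
apply/twistP; rewrite /t1 /t2 /d1 /d2 !umapM -/t1 -/t2 -/d1 -/d2.
rewrite !mulgA -(mulgA (t1 F)) t1d1C // -(mulgA (t2 F)) t2d2C // !mulgA tF.
by rewrite -!mulgA tV.
Qed.

Let gauge_side (t d : runit (galg k (G * G)%type) ->
    runit (galg k (G * G * G)%type)) a F (v w : runit (galg k (G * G * G)%type)) :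
  {morph t : x y / (x * y)%g} -> {morph d : x y / (x * y)%g} ->
  (t (udelta a^-1) * d (utens a a) = v)%g -> (v * t F = t F * v)%g ->
  (t (utens a a) * v = w)%g ->
  (t (gauge a F) * d (gauge a F) = w * (t F * d F) * d (udelta a^-1))%g.
Proof.
move=> tM dM vE vC <-; rewrite /gauge !tM !dM -!mulgA.
congr (_ * _)%g; rewrite (mulgA v) vC -!mulgA; congr (_ * _)%g.
by rewrite (mulgA (t _)) vE.
Qed.

Lemma gauge_twist a F : is_twist (uval F) -> is_twist (uval (gauge a F)).
Proof.
pose w1 : runit (galg k (G * G * G)%type) := utens (utens a a) a.
pose v1 : runit (galg k (G * G * G)%type) := utens 1%g a.
pose v2 : runit (galg k (G * G * G)%type) := utens (utens a 1%g) 1%g.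
have dV : delta (uval a^-1%g) * delta (uval a) = 1.
  by rewrite -deltaM uvalKV delta1.
move=> /twistP tF; apply/twistP.
rewrite (@gauge_side t1 d1 a F v1 w1); first last.
- by apply: uval_inj; rewrite !uvalM /uval /= /T1 -tensM mulr1 mul1r.
- apply: uval_inj; rewrite !uvalM /uval /= /T1 -!tensM.
  by rewrite !mulr1 !mul1r.
- apply: uval_inj; rewrite uvalM !uval_umap /= {2}/uval /= D1t /T1 -tensM.
  by rewrite dV mul1r.
- exact: umapM.
- exact: umapM.
rewrite (@gauge_side t2 d2 a F v2 w1); first last.
- apply: uval_inj; rewrite !uvalM /uval /= /T2 tassoc_tens -!tensM.
  by rewrite !uval1 !mulr1 mul1r.
- apply: uval_inj; rewrite !uvalM /uval /= /T2.
  by rewrite -tassoc_tens tens11 -!tassocM -!tensM !mulr1 !mul1r.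
- apply: uval_inj; rewrite uvalM !uval_umap /= {2}/uval /= D2t /T2.
  by rewrite -tassocM -tensM dV mul1r /uval /= -tassoc_tens tens11.
- exact: umapM.
- exact: umapM.
rewrite tF; congr (_ * _)%g.
by apply: uval_inj; rewrite !uval_umap coassoc.
Qed.

(* The group Z^2 of invariant twists. *)
Record invtwist := InvTwist {
  itval :> runit (galg k (G * G)%type);
  _ : invtwist_pred itval
}.

HB.instance Definition _ := [isSub for itval].
HB.instance Definition _ := [Choice of invtwist by <:].
HB.instance Definition _ :=
  SubChoice_isSubGroup.Build _ _ invtwist invtwist_closed.

End Twists.
Arguments invtwist : clear implicits.

Section Cohomology.
Variables (k : fieldType) (G : groupType).
Implicit Types (a b : runit (galg k G)).

(* The group A^1 of invertible central elements. *)
Definition central_pred : pred (runit (galg k G)) :=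
  fun a => `[< forall x : galg k G, uval a * x = x * uval a >].

Fact central_closed : group_closed central_pred.
Proof.
split=> [|a b /asboolP aC /asboolP bC]; apply/asboolP => x.
  by rewrite mulr1 mul1r.
have bVC : uval b^-1%g * x = x * uval b^-1%g.
  rewrite -[LHS]mulr1 -(uvalVK b) -[RHS]mul1r -(uvalKV b) -!mulrA.
  by congr (_ * _); rewrite !mulrA bC.
by rewrite uvalM -mulrA bVC mulrA aC mulrA.
Qed.

Record central_unit := CentralUnit {
  cuval :> runit (galg k G);
  _ : central_pred cuval
}.

HB.instance Definition _ := [isSub for cuval].
HB.instance Definition _ := [Choice of central_unit by <:].
HB.instance Definition _ :=
  SubChoice_isSubGroup.Build _ _ central_unit central_closed.

Lemma central_unitC (a : central_unit) (x : galg k G) :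
  uval a * x = x * uval a.
Proof. by have /asboolP := valP a; apply. Qed.

Lemma central_unitVC (a : central_unit) (x : galg k G) :
  uval (cuval a)^-1%g * x = x * uval (cuval a)^-1%g.
Proof.
by have /asboolP := group_closedV central_closed (valP a); apply.
Qed.

Lemma utens_centralC (a b : central_unit) (y : galg k (G * G)%type) :
  uval (utens a b) * y = y * uval (utens a b).
Proof.
move: y; apply: tens_ind => [|u v IH IH'|c u IH|x y].
- by rewrite mulr0 mul0r.
- by rewrite mulrDr mulrDl IH IH'.
- by rewrite -scalerAr -scalerAl IH.
by rewrite /uval /= -!tensM -/(uval a) -/(uval b) !central_unitC.
Qed.

Fact delta1_subproof (a : central_unit) :
  invtwist_pred (utens a a * udelta a^-1)%g.
Proof.
apply/asboolP; split.
  rewrite -[utens a a]mulg1 -/(gauge a 1%g); apply: gauge_twist.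
  by have [/asboolP[]] := @invtwist_closed k G.
move=> x; rewrite uvalM mulrA -utens_centralC -!mulrA; congr (_ * _).
by rewrite uval_umap -!deltaM central_unitVC.
Qed.

(* delta^1 *)
Definition delta1c (a : central_unit) : invtwist k G :=
  InvTwist (delta1_subproof a).

Lemma delta1cM : {morph delta1c : a b / (a * b)%g}.
Proof.
move=> a b; apply: val_inj; apply: uval_inj.
rewrite [RHS]/= !uvalM /= (utensM a b a b) invgM /udelta umapM !uvalM !uval_umap.
rewrite -!mulrA; congr (_ * _).
rewrite [RHS]mulrA -utens_centralC -[RHS]mulrA; congr (_ * _).
by rewrite -!deltaM central_unitVC.
Qed.

Definition delta1_im_pred : pred (invtwist k G) :=
  fun F => `[< exists a : central_unit, F = delta1c a >].

Fact delta1_im_closed : group_closed delta1_im_pred.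
Proof.
have d1 : delta1c 1%g = 1%g.
  by apply: (mulgI (delta1c 1%g)); rewrite -delta1cM !mulg1.
split=> [|F F' /asboolP[a ->] /asboolP[b ->]]; apply/asboolP.
  by exists 1%g.
exists (a * b^-1)%g; rewrite delta1cM; congr (_ * _)%g.
by apply: mulg1_eq; rewrite -delta1cM mulgV.
Qed.

Lemma delta1cC (a : central_unit) (F : invtwist k G) :
  (delta1c a * F = F * delta1c a)%g.
Proof.
apply: val_inj; apply: uval_inj; rewrite /= !uvalM uval_umap.
have /asboolP[_ iF] := valP F.
rewrite -mulrA iF (mulrA (uval (utens a a))) utens_centralC. by rewrite -mulrA.
Qed.

Fact delta1_im_norm (F F' : invtwist k G) :
  F \in delta1_im_pred -> (F ^ F')%g \in delta1_im_pred.
Proof.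
move=> /asboolP[a ->]; apply/asboolP; exists a.
by rewrite conjgE delta1cC mulKg.
Qed.

Definition delta1_im : normsubg (invtwist k G) :=
  NormSubg delta1_im_closed delta1_im_norm.

(* Z^2 / Im(delta^1) *)
Definition H2l := quotg delta1_im.
HB.instance Definition _ := Group.on H2l.

Definition in_G a : Prop := exists g : G, a = ugb g.

(* For an infinite G the inclusion a G a^-1 <= G would not be enough. *)
Definition in_normalizer a : Prop :=
  forall x, in_G x <-> in_G (a * x * a^-1)%g.

Definition conj_by a (f : G -> G) : Prop :=
  forall g, ugb (f g) = (a * ugb g * a^-1)%g.

Definition int_pred : pred (gaut G) :=
  fun f => `[< exists2 a, in_normalizer a & conj_by a f >].

Lemma in_normalizerV a : in_normalizer a -> in_normalizer a^-1%g.
Proof.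
move=> aN x; split=> [xG|]; last first.
  by move/(aN _); rewrite invgK !mulgA mulgV mul1g mulgK.
by apply/(aN _); rewrite invgK !mulgA mulgV mul1g mulgK.
Qed.

Lemma in_normalizerM a b :
  in_normalizer a -> in_normalizer b -> in_normalizer (a * b)%g.
Proof.
move=> aN bN x; rewrite (bN x) (aN (b * x * b^-1)%g).
by rewrite invgM !mulgA.
Qed.

Fact int_closed : group_closed int_pred.
Proof.
split=> [|f f' /asboolP[a aN fE] /asboolP[b bN f'E]]; apply/asboolP.
  exists 1%g => [x|g]; first by rewrite invg1 mulg1 mul1g.
  by rewrite invg1 mulg1 mul1g.
exists (a * b^-1)%g; first exact/in_normalizerM/in_normalizerV.
move=> g; rewrite gautME fE -{2}(gautKV f' g) f'E invgM invgK.
by rewrite !mulgA !mulgVK.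
Qed.

(* Int_k(G). *)
Record intg := IntG {
  intg_aut :> gaut G;
  _ : int_pred intg_aut
}.

HB.instance Definition _ := [isSub for intg_aut].
HB.instance Definition _ := [Choice of intg by <:].
HB.instance Definition _ :=
  SubChoice_isSubGroup.Build _ _ intg int_closed.

Definition inn_pred : pred intg :=
  fun f => `[< exists h : G, forall g, f g = (h * g * h^-1)%g >].

Fact inn_closed : group_closed inn_pred.
Proof.
split=> [|f f' /asboolP[h fE] /asboolP[h' f'E]]; apply/asboolP.
  by exists 1%g => g; rewrite invg1 mulg1 mul1g.
exists (h * h'^-1)%g => g.
have -> : (f / f')%g g = f ((intg_aut f')^-1%g g) by [].
rewrite fE -[in RHS](gautKV (intg_aut f') g) f'E invgM invgK.
by rewrite !mulgA !mulgVK.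
Qed.

Fact inn_norm (f f' : intg) : f \in inn_pred -> (f ^ f')%g \in inn_pred.
Proof.
move=> /asboolP[h fE]; apply/asboolP; exists ((intg_aut f')^-1%g h) => g.
have -> : (f ^ f')%g g = (intg_aut f')^-1%g (f (f' g)) by [].
by rewrite fE !gautM gautK gautV.
Qed.

Definition inn : normsubg intg := NormSubg inn_closed inn_norm.

(* Int_k(G) / Inn(G). *)
Definition outg := quotg inn.
HB.instance Definition _ := Group.on outg.

End Cohomology.

(* Main.v *)
Require Import Defs.
From mathcomp Require Import all_boot all_order all_algebra.
From mathcomp Require Import boolp monalg.

(* For a in N_k(G) the element da = (a (x) a) Delta(a^-1) is an invariant twist,
   and since Delta(a^-1) commutes with invariant twists, a . F = da F and
   d(ab) = da db.  So N_k(G) acts on H^2_l by left translations through the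
   homomorphism a |-> [da], and everything reduces to its kernel.  If da = dc with
   c central, then c^-1 a is grouplike, hence in G: the kernel is A^1 G, and
   N_k(G) / (A^1 G) = Int_k(G) / Inn(G).  Conversely, if F and a . F are both
   invariant, then a^-1 g a is grouplike for every g in G, so a normalizes G. *)

Set Implicit Arguments.
Unset Strict Implicit.
Unset Printing Implicit Defensive.

Import GRing.Theory.
Local Open Scope ring_scope.

(** * Grouplike elements of k[G] *)

Section Grouplike.
Context {k : fieldType} {G : groupType}.

Lemma mcoeff_tens (H : groupType) (a : galg k G) (b : galg k H) x y :
  (tens a b)@_(x, y) = a@_x * b@_y.
Proof.
elim/galg_ind: a => [|a a' IH IH'|c a IH|g].
- by rewrite tens0l !mcoeff0 mul0r.
- by rewrite tensDl !mcoeffD IH IH' mulrDl.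
- by rewrite tensZl !mcoeffZ IH mulrA.
elim/galg_ind: b => [|b b' IH IH'|c b IH|h].
- by rewrite tens0r !mcoeff0 mulr0.
- by rewrite tensDr !mcoeffD IH IH' mulrDr.
- by rewrite tensZr !mcoeffZ IH mulrCA.
rewrite tens_gb !gb_unlock !mcoeffU xpair_eqE.
by case: eqP => _; case: eqP => _; rewrite ?mulr1 ?mulr0.
Qed.

Lemma mcoeff_delta (a : galg k G) x y :
  (delta a)@_(x, y) = a@_x *+ (x == y).
Proof.
elim/galg_ind: a => [|a a' IH IH'|c a IH|g].
- by rewrite linear0 !mcoeff0 mul0rn.
- by rewrite linearD !mcoeffD IH IH' mulrnDl.
- by rewrite linearZ !mcoeffZ IH mulrnAr.
rewrite delta_gb !gb_unlock !mcoeffU xpair_eqE.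
case: (eqVneq g x) => [<-|_]; last by rewrite mul0rn.
by rewrite /=; case: eqP.
Qed.

(** Comparing coefficients at (x, y) makes the coefficients of a orthogonal idempotents of k. In a
    field, a nonzero one equals 1 and forces all the others to vanish. *)
Lemma grouplike_gb (a : galg k G) :
  a != 0 -> delta a = tens a a -> exists g, a = gb g.
Proof.
move=> a0 aD.
have aE x y : a@_x * a@_y = a@_x *+ (x == y).
  by rewrite -mcoeff_tens -aD mcoeff_delta.
have [x ax] : exists x, a@_x != 0.
  apply: contrapT => nx; case/eqP: a0; apply/malgP => x; rewrite mcoeff0.
  by apply/eqP/negPn/negP => ax; apply: nx; exists x.
exists x; apply/malgP => y; rewrite gb_unlock mcoeffU.
by apply: (mulfI ax); rewrite aE; case: eqP => _; rewrite ?mulr1 ?mulr0.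
Qed.

End Grouplike.

(** * Group elements as units, and invariance *)

Section NormalizerTwists.
Context {k : fieldType} {G : groupType}.
Implicit Types (a b : runit (galg k G)) (F : runit (galg k (G * G)%type)).

Lemma ugb1 : ugb 1%g = 1%g :> runit (galg k G).
Proof. exact: uval_inj. Qed.

Lemma ugbM (g h : G) : ugb (g * h)%g = (ugb g * ugb h)%g :> runit (galg k G).
Proof. by apply: uval_inj; rewrite /uval /= gbM. Qed.

Lemma ugbV (g : G) : ugb g^-1%g = (ugb g)^-1%g :> runit (galg k G).
Proof. by apply/esym/mulg1_eq; rewrite -ugbM mulgV ugb1. Qed.

Lemma ugb_inj : injective (@ugb k G).
Proof. by move=> g h /(congr1 (@uval _)) /gb_inj. Qed.

Lemma udelta_ugb (g : G) :
  udelta (ugb g : runit (galg k G)) = utens (ugb g) (ugb g).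
Proof. by apply: uval_inj; rewrite uval_umap /uval /= delta_gb tens_gb. Qed.

Lemma udeltaM : {morph (@udelta k G) : a b / (a * b)%g}.
Proof. exact: umapM. Qed.

Lemma grouplike_in_G a : udelta a = utens a a -> in_G a.
Proof.
move=> aD; have [|g aE] := @grouplike_gb k G (uval a) _ (congr1 (@uval _) aD).
  apply/eqP => a0; have := uvalK a; rewrite a0 mul0r => /esym/eqP.
  by rewrite oner_eq0.
by exists g; apply: uval_inj.
Qed.

Lemma is_invariant_ugb F :
  (forall g : G, udelta (ugb g) * F = F * udelta (ugb g))%g ->
  is_invariant (uval F).
Proof.
move=> iF; apply: galg_ind => [|x y IH IH'|c x IH|g].
- by rewrite linear0 mul0r mulr0.
- by rewrite linearD mulrDl mulrDr IH IH'.
- by rewrite linearZ -scalerAl -scalerAr IH.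
by have /(congr1 (@uval _)) := iF g.
Qed.

(** Moves invariance into the unit group, where cancellation is available; nothing is lost because
    the units coming from G span k[G]. *)
Lemma is_invariantP F :
  is_invariant (uval F) <-> forall a, (udelta a * F = F * udelta a)%g.
Proof.
split=> [iF a|iF]; first by apply: uval_inj; rewrite !uvalM iF.
exact/is_invariant_ugb.
Qed.

(** * Gauge transforms and the normalizer of G *)

Lemma gaugeV a F : gauge a^-1%g (gauge a F) = F.
Proof.
rewrite /gauge !mulgA -utensM mulVg utens11 mul1g -mulgA -udeltaM invgK mulVg.
by rewrite /udelta umap1 mulg1.
Qed.

Lemma in_G_normalizer a g : in_normalizer a -> in_G (a * ugb g * a^-1)%g.
Proof. by move=> aN; apply/(aN (ugb g)); exists g. Qed.

Lemma normalizerP a :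
  (forall g, in_G (a * ugb g * a^-1)%g) ->
  (forall g, in_G (a^-1 * ugb g * a)%g) -> in_normalizer a.
Proof.
move=> aG aVG x; split=> [[g ->]//|[g xE]].
have [h hE] := aVG g; exists h; rewrite -hE -xE.
by rewrite !mulgA mulVg mul1g mulgVK.
Qed.

(** With h = a^-1 g a in G, moving g (x) g past a (x) a turns it into h (x) h = Delta(h). This
    commutes with F, and Delta(h) Delta(a^-1) = Delta(a^-1) Delta(g). *)
Lemma gauge_invariant a F :
  in_normalizer a -> is_invariant (uval F) -> is_invariant (uval (gauge a F)).
Proof.
move=> aN /is_invariantP iF; apply: is_invariant_ugb => g.
have [h] := in_G_normalizer g (in_normalizerV aN); rewrite invgK => hE.
have ga : (ugb g * a = a * ugb h)%g by rewrite -hE !mulgA mulgV mul1g.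
have aVg : (a^-1 * ugb g = ugb h * a^-1)%g by rewrite -hE mulgK.
rewrite /gauge {1}udelta_ugb !mulgA -utensM ga utensM -udelta_ugb.
by rewrite -(mulgA _ (udelta _) F) iF -!mulgA -!udeltaM aVg.
Qed.

(** Put u = a^-1 g a. Invariance of a . F under Delta(g), multiplied on the right by Delta(a), reads
    (a (x) a)(u (x) u) F = (a (x) a) F Delta(u). Since F commutes with Delta(u), cancelling makes u
    grouplike. *)
Lemma gauge_conj_in_G a F (g : G) :
  is_invariant (uval F) -> is_invariant (uval (gauge a F)) ->
  in_G (a^-1 * ugb g * a)%g.
Proof.
move=> /is_invariantP iF /is_invariantP /(_ (ugb g)) E.
apply: grouplike_in_G; apply: (mulIg F); apply: (mulgI (utens a a)).
rewrite iF [RHS]mulgA -utensM !mulgA mulgV mul1g utensM -udelta_ugb.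
by rewrite !udeltaM !mulgA -[in LHS]E /gauge !mulgA -(mulgA _ (udelta a^-1)%g)
  -udeltaM mulVg /udelta umap1 mulg1.
Qed.

Lemma gauge_in_normalizer a F :
  is_invariant (uval F) -> is_invariant (uval (gauge a F)) -> in_normalizer a.
Proof.
move=> iF iF'; apply: normalizerP => g; last exact: gauge_conj_in_G iF iF'.
(* The other inclusion is the same lemma for a^-1 and a . F, whose gauge transform is F. *)
rewrite -[X in (X * ugb g)%g]invgK; apply: (@gauge_conj_in_G _ (gauge a F)) => //.
by rewrite gaugeV.
Qed.

(** * The invariant twist da of a normalizing unit *)

Lemma invtwistP (F : invtwist k G) :
  is_twist (uval F) /\ is_invariant (uval F).
Proof. by have /asboolP := valP F. Qed.

Fact ntwist_subproof a : in_normalizer a -> invtwist_pred (gauge a 1%g).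
Proof.
move=> aN; have [t1 i1] := invtwistP (1%g : invtwist k G).
by apply/asboolP; split; [apply: gauge_twist|apply: gauge_invariant].
Qed.

(** This is da, seen as the gauge transform of the trivial twist; on central units it is
    [delta1c]. *)
Definition ntwist a (aN : in_normalizer a) : invtwist k G :=
  InvTwist (ntwist_subproof aN).

Lemma gauge_ntwist a (aN : in_normalizer a) (F : invtwist k G) :
  itval (ntwist aN * F)%g = gauge a F.
Proof.
have [_ /is_invariantP iF] := invtwistP F.
have -> : itval (ntwist aN * F)%g = (gauge a 1 * itval F)%g by [].
by rewrite /gauge mulg1 -!mulgA iF.
Qed.

(** By [gauge_ntwist] the product da db is a . (b . 1), which is (ab) . 1. *)
Lemma ntwistM a b (aN : in_normalizer a) (bN : in_normalizer b)
    (abN : in_normalizer (a * b)%g) :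
  ntwist abN = (ntwist aN * ntwist bN)%g.
Proof.
apply: val_inj; rewrite [RHS]gauge_ntwist /= /gauge !mulg1 utensM invgM udeltaM.
by rewrite !mulgA.
Qed.

(** * Normalizing units and the automorphisms they induce *)

Lemma conj_by_in_normalizer a (f : gaut G) : conj_by a f -> in_normalizer a.
Proof.
move=> aE; apply: normalizerP => g; first by rewrite -aE; exists (f g).
exists ((f^-1)%g g); rewrite -{1}(gautKV f g) aE.
by rewrite !mulgA mulVg mul1g mulgVK.
Qed.

Lemma conj_byM a b (f f' : gaut G) :
  conj_by a f -> conj_by b f' -> conj_by (a * b)%g (f * f')%g.
Proof. by move=> aE bE g; rewrite gautME aE bE invgM !mulgA. Qed.

Lemma conj_byV a (f : gaut G) : conj_by a f -> conj_by a^-1%g (f^-1)%g.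
Proof.
move=> aE g; rewrite invgK -{2}(gautKV f g) aE.
by rewrite !mulgA mulVg mul1g mulgVK.
Qed.

Lemma normalizer_intg a :
  in_normalizer a -> exists f : intg k G, conj_by a (intg_aut f).
Proof.
move=> aN; have aNV := in_normalizerV aN.
(* Used for both a and a^-1: the two chosen maps are mutually inverse because [ugb] is injective. *)
have fE b (bN : in_normalizer b) : {f : G -> G | conj_by b f}.
  exists (fun g => projT1 (cid (in_G_normalizer g bN))) => g.
  by case: cid => h /= ->.
have [[f fa] [f' f'a]] := (fE _ aN, fE _ aNV).
have fG : is_gaut f.
  apply/asboolP; split=> [x y|].
    by apply: ugb_inj; rewrite ugbM !fa ugbM !mulgA mulgVK.
  by exists f' => g; apply: ugb_inj; rewrite ?(fa, f'a) ?(fa, f'a) ?invgK;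
    rewrite !mulgA ?mulVg ?mulgV mul1g ?mulgVK ?mulgK.
have fI : int_pred k (GAut fG) by apply/asboolP; exists a.
by exists (IntG fI).
Qed.

(** Choice turns the mere existence of a into data, as needed to define [out_class] as a
    function. *)
Lemma intg_normalizer (f : intg k G) :
  {a : runit (galg k G) | in_normalizer a & conj_by a (intg_aut f)}.
Proof. by apply: cid2; have /asboolP := valP f. Qed.

(** The unit b^-1 a commutes with every element of G, and G spans k[G]. *)
Lemma conj_by_centralE a b (f : G -> G) :
  conj_by a f -> conj_by b f ->
  exists c : central_unit k G, a = (b * cuval c)%g.
Proof.
move=> aE bE.
suff cP : central_pred (b^-1 * a)%g by exists (CentralUnit cP); rewrite mulVKg.
apply/asboolP; apply: galg_ind => [|x y IH IH'|c x IH|g].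
- by rewrite mul0r mulr0.
- by rewrite mulrDl mulrDr IH IH'.
- by rewrite -scalerAl -scalerAr IH.
suff /(congr1 (@uval _)) : (b^-1 * a * ugb g = ugb g * (b^-1 * a))%g by [].
apply: (mulgI b); apply: (mulIg a^-1%g).
by rewrite !mulgA mulgV mul1g mulgK -aE bE.
Qed.

Lemma central_conj_by (c : central_unit k G) : conj_by (cuval c) id.
Proof.
move=> g; have -> : (cuval c * ugb g = ugb g * cuval c)%g.
  by apply: uval_inj; rewrite !uvalM central_unitC.
by rewrite mulgK.
Qed.

Lemma central_in_normalizer (c : central_unit k G) : in_normalizer (cuval c).
Proof. exact: (@conj_by_in_normalizer _ 1%g (central_conj_by c)). Qed.

Lemma ntwist_central (c : central_unit k G) (cN : in_normalizer (cuval c)) :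
  ntwist cN = delta1c c.
Proof. by apply: val_inj; rewrite /= /gauge mulg1. Qed.

(** * The kernel of a |-> [da] and the embedding it induces *)

Lemma qclass_eq1 (T : groupType) (S : normsubg T) x :
  qclass S x = 1%g <-> x \in (S : {pred T}).
Proof.
have := qclass_eqP S 1%g x; rewrite invg1 mul1g qclass1 => <-.
by split=> ->.
Qed.

Lemma ntwist_class1 a (aN : in_normalizer a) (f : intg k G) :
  conj_by a (intg_aut f) ->
  qclass (delta1_im k G) (ntwist aN) = 1%g <-> qclass (inn k G) f = 1%g.
Proof.
move=> aE; split.
  move=> /qclass_eq1/asboolP[c /(congr1 (@itval _ _))].
  rewrite /= /gauge mulg1 => E.
  (* From da = dc this unit is grouplike, so a = c h with h in G, and c does not affect
     conjugation. *)
  have [|h hE] := @grouplike_in_G ((cuval c)^-1 * a)%g.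
    rewrite utensM udeltaM; apply: (mulgI (utens (cuval c) (cuval c))).
    rewrite [RHS]mulgA -utensM mulgV utens11 mul1g mulgA -E -mulgA -udeltaM.
    by rewrite mulVg /udelta umap1 mulg1.
  apply/qclass_eq1/asboolP; exists h => g; apply: ugb_inj.
  rewrite aE -(mulVKg (cuval c) a) hE !ugbM ugbV invgM.
  have -> x : (cuval c * ugb h * x * ((ugb h)^-1 * (cuval c)^-1)
       = cuval c * (ugb h * x * (ugb h)^-1) * (cuval c)^-1)%g by rewrite !mulgA.
  by rewrite -ugbV -!ugbM -central_conj_by.
move=> /qclass_eq1/asboolP[h hE]; apply/qclass_eq1/asboolP.
have ha : conj_by (ugb h : runit (galg k G)) (intg_aut f)
  by move=> g; rewrite hE !ugbM ugbV.
have [c aEc] := conj_by_centralE aE ha.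
(* With a = h c, the factor h (x) h = Delta(h) commutes with the invariant twist dc and cancels
   Delta(h^-1), leaving da = dc. *)
exists c; apply: val_inj; rewrite /= /gauge mulg1 aEc utensM invgM udeltaM.
have /is_invariantP iF := (invtwistP (delta1c c)).2.
rewrite mulgA -(mulgA (utens (ugb h) (ugb h))) -udelta_ugb iF.
by rewrite -mulgA -udeltaM mulgV /udelta umap1 mulg1.
Qed.

(** Uses a chosen automorphism in s and a chosen unit inducing it; [out_class_qclass] shows
    independence of both choices. *)
Definition out_class (s : outg k G) : H2l k G :=
  qclass (delta1_im k G) (ntwist (s2valP (intg_normalizer (repr s)))).

(** If b induces the chosen f', then b^-1 a induces the inner automorphism f'^-1 f. So d(b^-1 a) has
    trivial class, while da = db d(b^-1 a). *)
Lemma out_class_qclass a (aN : in_normalizer a) (f : intg k G) :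
  conj_by a (intg_aut f) ->
  out_class (qclass (inn k G) f) = qclass (delta1_im k G) (ntwist aN).
Proof.
move=> aE; rewrite /out_class; set f' := repr _.
case: (intg_normalizer f') => b bN bE.
have ff' : qclass (inn k G) (f'^-1 * f)%g = 1%g.
  by apply/qclass_eq1/qclass_eqP; rewrite qclassK.
have baE : conj_by (b^-1 * a)%g (intg_aut (f'^-1 * f)%g).
  exact: conj_byM (conj_byV bE) aE.
have baN := conj_by_in_normalizer baE.
have E := (ntwist_class1 baN baE).2 ff'.
have -> : ntwist aN = (ntwist bN * ntwist baN)%g.
  have bbaN : in_normalizer (b * (b^-1 * a))%g by rewrite mulVKg.
  by rewrite -(ntwistM bN baN bbaN); apply: val_inj; rewrite /= mulVKg.
by rewrite qclassM E mulg1; congr qclass; apply: val_inj.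
Qed.

Lemma out_classP (s : outg k G) : exists a (aN : in_normalizer a) (f : intg k G),
  [/\ conj_by a (intg_aut f), s = qclass (inn k G) f
    & out_class s = qclass (delta1_im k G) (ntwist aN)].
Proof.
rewrite -(qclassK s); have [a aN aE] := intg_normalizer (repr s).
by exists a, aN, (repr s); split=> //; apply: out_class_qclass.
Qed.

Lemma out_classM : {morph out_class : s t / (s * t)%g}.
Proof.
move=> s t; have [a [aN [f [aE -> ->]]]] := out_classP s.
have [b [bN [f' [bE -> ->]]]] := out_classP t.
have abE := conj_byM aE bE; have abN := conj_by_in_normalizer abE.
by rewrite -!qclassM -(ntwistM aN bN abN); apply: out_class_qclass.
Qed.

Lemma out_class_eq1 s : out_class s = 1%g -> s = 1%g.
Proof.
by have [a [aN [f [aE -> ->]]]] := out_classP s => /(ntwist_class1 aN aE).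
Qed.

Lemma out_class1 : out_class 1%g = 1%g.
Proof. by apply: (mulgI (out_class 1%g)); rewrite -out_classM !mulg1. Qed.

Lemma out_classV s : out_class s^-1%g = (out_class s)^-1%g.
Proof. by apply/esym/mulg1_eq; rewrite -out_classM mulgV out_class1. Qed.

Lemma out_class_inj : injective out_class.
Proof.
move=> s t E; apply: (mulgI t^-1%g); rewrite mulVg; apply: out_class_eq1.
by rewrite out_classM out_classV E mulVg.
Qed.

Lemma gauge_equivP (F F' : invtwist k G) :
  gauge_equiv F F' <->
  exists a (aN : in_normalizer a), F' = (ntwist aN * F)%g.
Proof.
split=> [[a aE]|[a [aN ->]]]; last by exists a; apply: gauge_ntwist.
have [[_ iF] [_ iF']] := (invtwistP F, invtwistP F').
have aN : in_normalizer a by apply: (gauge_in_normalizer iF); rewrite -aE.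
by exists a, aN; apply: val_inj; rewrite [RHS]gauge_ntwist.
Qed.

End NormalizerTwists.

Theorem corollary2p3 (k : fieldType) (G : groupType)
    (k_char0 : [pchar k]%R =i pred0) :
  (* (a) *)
  (exists act : outg k G -> H2l k G -> H2l k G,
    [/\ is_gaction act,
        (forall (a : runit (galg k G)) (f : intg k G) (F : invtwist k G),
           in_normalizer a -> conj_by a f ->
           exists2 F' : invtwist k G, itval F' = gauge a F
             & act (qclass (inn k G) f) (qclass (delta1_im k G) F)
               = qclass (delta1_im k G) F'),
        free_gaction act
      & forall x y : H2l k G,
          same_orbit act x y <->
          exists F F' : invtwist k G,
            [/\ qclass (delta1_im k G) F = x, qclass (delta1_im k G) F' = y
              & gauge_equiv F F'] ])
  (* (b) *)
  /\ ((forall F F' : invtwist k G,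
         gauge_equiv F F' <->
         qclass (delta1_im k G) F = qclass (delta1_im k G) F')
      <-> (forall s : outg k G, s = 1%g))
  (* (c) *)
  /\ (exists2 S : {pred H2l k G}, group_closed S
        & exists f : outg k G -> H2l k G,
            [/\ {morph f : s t / (s * t)%g}, injective f
              & forall x, x \in S <-> exists s, f s = x]).
Proof.
split; last split.
- exists (fun s x => out_class s * x)%g; split.
  + by split=> [x|s t x]; rewrite ?out_class1 ?mul1g // out_classM mulgA.
  + move=> a f F aN aE; exists (ntwist aN * F)%g; first exact: gauge_ntwist.
    by rewrite (out_class_qclass aN aE) -qclassM.
  (* A translation with a fixed point is by 1, and [out_class] has trivial kernel. *)
  + by move=> s x E; apply: out_class_eq1; apply: (mulIg x); rewrite E mul1g.
  + move=> x y; split=> [[s <-]|[F [F' [<- <- /gauge_equivP[a [aN ->]]]]]].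
      have [a [aN [f [_ _ ->]]]] := out_classP s.
      exists (repr x), (ntwist aN * repr x)%g; split.
      * exact: qclassK.
      * by rewrite qclassM qclassK.
      * by apply/gauge_equivP; exists a, aN.
    have [f aE] := normalizer_intg aN; exists (qclass (inn k G) f).
    by rewrite (out_class_qclass aN aE) -qclassM.
- split=> [E s|out1 F F'].
    have [a [aN [f [aE -> _]]]] := out_classP s.
    (* The hypothesis is applied to the gauge equivalent twists 1 and da. *)
    apply/(ntwist_class1 aN aE); rewrite -[RHS]qclass1; apply/esym/E/gauge_equivP.
    by exists a, aN; rewrite mulg1.
  split=> [/gauge_equivP[a [aN ->]]|/qclass_eqP/asboolP[c E]].
    have [f aE] := normalizer_intg aN.
    have /(ntwist_class1 aN aE) E := out1 (qclass (inn k G) f).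
    by rewrite qclassM E mul1g.
  (* Here F^-1 F' = dc, and dc is central in Z^2, so F' = dc F = c . F. *)
  apply/gauge_equivP; exists (cuval c), (central_in_normalizer c).
  by rewrite ntwist_central delta1cC -E mulVKg.
(* The subgroup is the image of the injective homomorphism [out_class]. *)
- exists (fun x : H2l k G => `[< exists s, out_class s = x >]).
    split=> [|x y /asboolP[s <-] /asboolP[t <-]]; apply/asboolP.
      by exists 1%g; apply: out_class1.
    by exists (s * t^-1)%g; rewrite out_classM out_classV.
  exists out_class; split; [exact: out_classM|exact: out_class_inj|].
  by move=> x; split=> [/asboolP|xS] //; apply/asboolP.
Qed.
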